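(* Let $\mathcal E:0\to H\xrightarrow{\alpha}E\xrightarrow{p}R\to0$ be an abelian extension (with a section) of a Leibniz conformal algebra $R$ by a $\mathbb C[\partial]$-module $H$. A pair $(d_R,d_H)\in\mathrm{Der}^L(R)\times\mathrm{Der}^L(H)$ is extensible if and only if $(d_R,d_H)\in\mathrm g(R,H)$ and $\mathcal W(d_R,d_H)=0$.
   Context: All vector spaces are over $\mathbb C$ and all $\mathbb C[\partial]$-modules are finitely generated. A Leibniz conformal algebra is a $\mathbb C[\partial]$-module $R$ with a $\mathbb C$-bilinear $\lambda$-bracket $R\times R\to R[\lambda]$, $(a,b)\mapsto[a_\lambda b]$, such that $[(\partial a)_\lambda b]=-\lambda[a_\lambda b]$, $[a_\lambda\partial b]=(\partial+\lambda)[a_\lambda b]$ and $[a_\lambda[b_\mu c]]=[[a_\lambda b]_{\lambda+\mu}c]+[b_\mu[a_\lambda c]]$. $\mathrm{Der}^L(R)$ is the set of left derivations: $\mathbb C[\partial]$-module homomorphisms $d:R\to R$ with $d([a_\lambda b])=[a_\lambda d(b)]+[d(a)_\lambda b]$. A $\mathbb C[\partial]$-module $H$ is viewed as a Leibniz conformal algebra with zero bracket, so $\mathrm{Der}^L(H)$ is the set of all $\mathbb C[\partial]$-module endomorphisms of $H$. An abelian extension of $R$ by $H$ is a short exact sequence $0\to H\xrightarrow{\alpha}E\xrightarrow{p}R\to0$ of Leibniz conformal algebras and homomorphisms, $H$ having zero bracket ($H$ is identified with $\alpha(H)$). A section is a $\mathbb C[\partial]$-module homomorphism $s:R\to E$ with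 $p\circ s=\mathrm{id}_R$. The induced $R$-module structure on $H$ (independent of $s$) is $a\triangleright_\lambda h=[s(a)_\lambda h]$, $h\triangleleft_\lambda a=[h_\lambda s(a)]$, and the induced $2$-cocycle is $\chi_\lambda(a,b)=[s(a)_\lambda s(b)]-s([a_\lambda b])$. $C^1(R,H)$ is the space of $\mathbb C[\partial]$-module homomorphisms $R\to H$, and $C^2(R,H)$ is the space of $\mathbb C$-bilinear maps $f_\lambda:R\times R\to H[\lambda]$ with $f_\lambda(\partial a,b)=-\lambda f_\lambda(a,b)$, $f_\lambda(a,\partial b)=(\partial+\lambda)f_\lambda(a,b)$. For $\beta\in C^1(R,H)$, $(\delta\beta)_\lambda(a,b)=a\triangleright_\lambda\beta(b)+\beta(a)\triangleleft_\lambda b-\beta([a_\lambda b])$; for $f\in C^2(R,H)$, $(\delta f)_{\lambda,\mu}(a,b,c)=a\triangleright_\lambda f_\mu(b,c)-b\triangleright_\mu f_\lambda(a,c)-f_\lambda(a,b)\triangleleft_{\lambda+\mu}c-f_{\lambda+\mu}([a_\lambda b],c)-f_\mu(b,[a_\lambda c])+f_\lambda(a,[b_\mu c])$. $Z^2(R,H)=\ker\delta|_{C^2}$ and $H^2(R,H)=Z^2(R,H)/\delta C^1(R,H)$. The class $[\chi]\in H^2(R,H)$ does not depend on $s$. $\mathrm g(R,H)$ is the set of $(d_R,d_H)\in\mathrm{Der}^L(R)\times\mathrm{Der}^L(H)$ with $d_H(a\triangleright_\lambda h)=a\triangleright_\lambda d_H(h)+d_R(a)\triangleright_\lambda h$ and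 $d_H(h\triangleleft_\lambda a)=h\triangleleft_\lambda d_R(a)+d_H(h)\triangleleft_\lambda a$ for all $a\in R,h\in H$. For $(d_R,d_H)\in\mathrm g(R,H)$ and $f\in C^2(R,H)$, $\Phi(d_R,d_H)(f)_\lambda(a,b)=d_H(f_\lambda(a,b))-f_\lambda(d_R(a),b)-f_\lambda(a,d_R(b))$; this induces a linear map on $H^2(R,H)$, and the Wells map is $\mathcal W:\mathrm g(R,H)\to H^2(R,H)$, $\mathcal W(d_R,d_H)=\Phi(d_R,d_H)([\chi])$. $(d_R,d_H)\in\mathrm{Der}^L(R)\times\mathrm{Der}^L(H)$ is extensible if there is $d_E\in\mathrm{Der}^L(E)$ with $d_E\circ\alpha=\alpha\circ d_H$ and $d_R\circ p=p\circ d_E$. *)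

(* Defs.v *)
From HB Require Import structures.
From mathcomp Require Import all_boot all_algebra.
From mathcomp Require Import finmap.
From mathcomp Require Import monalg.
From mathcomp Require Import boolp classical_sets functions reals complex.

Set Implicit Arguments.
Unset Strict Implicit.
Unset Printing Implicit Defensive.

Import GRing.Theory.
Local Open Scope ring_scope.

Section LinearExtension.

Variables (I : choiceType) (M V : zmodType).
Implicit Types (F : I -> M -> V) (g : {malg M[I]}).

(* additive extension to polynomials: \sum_k x_k . X^k |-> \sum_k F k x_k *)
Definition mext F g : V := \sum_(k <- msupp g) F k g@_k.

Definition coef_additive F := forall k, zmod_morphism (F k).

Lemma zmod_morphism0 (f : M -> V) : zmod_morphism f -> f 0 = 0.
Proof. by move=> fB; rewrite -[X in f X](subrr (0 : M)) fB subrr. Qed.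

Lemma zmod_morphismN (f : M -> V) x : zmod_morphism f -> f (- x) = - f x.
Proof. by move=> fB; rewrite -sub0r fB zmod_morphism0 // sub0r. Qed.

Lemma zmod_morphismD (f : M -> V) x y : zmod_morphism f -> f (x + y) = f x + f y.
Proof. by move=> fB; rewrite -{1}[y]opprK fB zmod_morphismN // opprK. Qed.

Lemma mextEw F g (D : {fset I}) : (forall k, F k 0 = 0) ->
  (msupp g `<=` D)%fset -> mext F g = \sum_(k <- D) F k g@_k.
Proof.
move=> F0 sgD; rewrite /mext.
apply: big_fset_incl => //= k _.
by move=> /mcoeff_outdom ->.
Qed.

Lemma mextB F : coef_additive F -> zmod_morphism (mext F).
Proof.
move=> FB g h.
have F0 k : F k 0 = 0 by apply: zmod_morphism0.
pose D := (msupp (g - h) `|` (msupp g `|` msupp h))%fset.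
rewrite !(@mextEw F _ D) //.
- by rewrite -sumrB; apply: eq_bigr => k _; rewrite mcoeffB FB.
- by rewrite /D fsubsetU // fsubsetUr orbT.
- by rewrite /D fsubsetU // fsubsetUl orbT.
- by rewrite /D fsubsetUl.
Qed.

Lemma eq_mext F G g : (forall k x, F k x = G k x) -> mext F g = mext G g.
Proof. by move=> eqFG; apply: eq_bigr => k _. Qed.

Lemma mext_sub F G g : mext (fun k x => F k x - G k x) g = mext F g - mext G g.
Proof. by rewrite /mext sumrB. Qed.

Lemma mextU F k x : F k 0 = 0 -> mext F << x *g k >> = F k x.
Proof.
move=> F0; rewrite /mext msuppU; case: eqP => [->|_].
  by rewrite big_seq_fset0 F0.
by rewrite big_seq_fset1 mcoeffUU.
Qed.

End LinearExtension.

(* polynomials with coefficients in the module M, in the variable lambda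
   (I = nat) or in the variables lambda, mu (I = nat * nat);
   g@_n, resp. g@_(m, n), is the coefficient of lambda^n, resp. of
   lambda^m mu^n *)
Definition mpol (I : choiceType) (M : zmodType) := {malg M[I]}.

HB.instance Definition _ (I : choiceType) (M : zmodType) :=
  GRing.Zmodule.on (mpol I M).

Notation lpoly M := (mpol nat M).
Notation lpoly2 M := (mpol (nat * nat)%type M).

Section CoefficientMap.

Variables (I : choiceType) (M N : zmodType).

(* f applied to all the coefficients *)
Definition mpol_map (f : M -> N) (g : mpol I M) : mpol I N :=
  mext (fun k x => << f x *g k >>) g.

Lemma coef_mpol_map f g k : f 0 = 0 -> (mpol_map f g)@_k = f g@_k.
Proof.
move=> f0; rewrite /mpol_map /mext raddf_sum /=.
case: (msuppP g k) => [kg|kg].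
  rewrite (big_fsetD1 k) //= mcoeffUU big1_fset ?addr0 // => i.
  by rewrite in_fsetD1 mcoeffU; case: eqP.
rewrite f0 big1_fset // => i ig _.
by rewrite mcoeffU; case: eqP kg => // <-; rewrite ig.
Qed.

Lemma mpol_mapB f : zmod_morphism f -> zmod_morphism (mpol_map f).
Proof.
move=> fB; apply: mextB => k x y.
by rewrite fB raddfB.
Qed.

Lemma mpol_map_inj f : zmod_morphism f -> injective f -> injective (mpol_map f).
Proof.
move=> fB inj_f g h /malgP eq_gh; apply/malgP => k; apply: inj_f.
by have := eq_gh k; rewrite !coef_mpol_map //; apply: zmod_morphism0.
Qed.

End CoefficientMap.

Section CoefficientMapComp.

Variables (I : choiceType) (L M N : zmodType).

Lemma mpol_map_comp (f : M -> N) (h : L -> M) (g : mpol I L) :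
  f 0 = 0 -> h 0 = 0 -> mpol_map f (mpol_map h g) = mpol_map (f \o h) g.
Proof.
by move=> f0 h0; apply/malgP => k; rewrite !coef_mpol_map //= h0.
Qed.

Lemma eq_mpol_map (f h : M -> N) (g : mpol I M) : f =1 h -> mpol_map f g = mpol_map h g.
Proof. by move=> eq_fh; apply: eq_mext => k x; rewrite eq_fh. Qed.

Lemma raddf_mext (F : I -> M -> N) (h : N -> L) (g : mpol I M) :
  zmod_morphism h -> h (mext F g) = mext (fun k x => h (F k x)) g.
Proof.
move=> hB; pose h' : {additive N -> L} :=
  HB.pack h (GRing.isZmodMorphism.Build N L h hB).
exact: (raddf_sum h').
Qed.

Lemma mext_mpol_map (F : I -> N -> L) (h : M -> N) (g : mpol I M) :
  (forall k, F k 0 = 0) -> h 0 = 0 ->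
  mext F (mpol_map h g) = mext (fun k x => F k (h x)) g.
Proof.
move=> F0 h0; rewrite (@mextEw _ _ _ F _ (msupp g)) //.
  by apply: eq_bigr => k _; rewrite coef_mpol_map.
apply/fsubsetP => k; rewrite -!mcoeff_neq0 coef_mpol_map //.
by apply: contra_neq => ->.
Qed.

End CoefficientMapComp.

Section CoefficientScale.

Variables (I : choiceType) (A : nzRingType) (M : lmodType A).

Definition mpol_scale (a : A) (g : mpol I M) : mpol I M := mpol_map ( *:%R a) g.

Lemma coef_scale a g k : (mpol_scale a g)@_k = a *: g@_k.
Proof. by rewrite coef_mpol_map ?scaler0. Qed.

Fact mpol_scaleA a b g :
  mpol_scale a (mpol_scale b g) = mpol_scale (a * b) g.
Proof. by apply/malgP => k; rewrite !coef_scale scalerA. Qed.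

Fact mpol_scale1 : left_id 1 mpol_scale.
Proof. by move=> g; apply/malgP => k; rewrite coef_scale scale1r. Qed.

Fact mpol_scaleDr : right_distributive mpol_scale +%R.
Proof.
move=> a g h; apply/malgP => k.
by rewrite coef_scale !mcoeffD !coef_scale scalerDr.
Qed.

Fact mpol_scaleDl g : {morph mpol_scale^~ g : a b / a + b}.
Proof.
move=> a b; apply/malgP => k.
by rewrite mcoeffD !coef_scale scalerDl.
Qed.

HB.instance Definition _ := GRing.Zmodule_isLmodule.Build A (mpol I M)
  mpol_scaleA mpol_scale1 mpol_scaleDr mpol_scaleDl.

Lemma mpol_scaleE a (g : mpol I M) : a *: g = mpol_map ( *:%R a) g.
Proof. by []. Qed.

End CoefficientScale.

(* multiplication by lambda *)
Definition lam (M : zmodType) (g : lpoly M) : lpoly M :=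
  mext (fun k x => << x *g k.+1 >>) g.

Section LambdaMul.

Variables (M N : zmodType).

Lemma lamB : zmod_morphism (@lam M).
Proof. by apply: mextB => k x y; rewrite raddfB. Qed.

Lemma mpol_mapU (I : choiceType) (f : M -> N) (x : M) (k : I) : f 0 = 0 ->
  mpol_map f << x *g k >> = << f x *g k >>.
Proof. by move=> f0; rewrite /mpol_map mextU // f0 raddf0. Qed.

Lemma mpol_map_lam (f : M -> N) (g : lpoly M) :
  zmod_morphism f -> mpol_map f (lam g) = lam (mpol_map f g).
Proof.
move=> fB; have f0 := zmod_morphism0 fB.
rewrite /lam (raddf_mext _ _ (mpol_mapB fB)) mext_mpol_map // => [|k].
  by apply: eq_mext => k x; rewrite mpol_mapU.
by rewrite raddf0.
Qed.

End LambdaMul.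

Section Substitution.

Variables (A B M : zmodType).
Implicit Types (f : A -> B -> lpoly M).

(* f_lambda(a, g(mu)) *)
Definition sub_lam_mu f (a : A) (g : lpoly B) : lpoly2 M :=
  mext (fun n b => mext (fun m x => << x *g (m, n) >>) (f a b)) g.

(* f_mu(a, g(lambda)) *)
Definition sub_mu_lam f (a : A) (g : lpoly B) : lpoly2 M :=
  mext (fun m b => mext (fun n x => << x *g (m, n) >>) (f a b)) g.

(* f_(lambda + mu)(g(lambda), b), with
   lambda^k (lambda + mu)^l =
     \sum_(i <= l) 'C(l, i) lambda^(k + i) mu^(l - i) *)
Definition sub_lam_add f (g : lpoly A) (b : B) : lpoly2 M :=
  mext (fun k a =>
    mext (fun l x =>
      \sum_(i < l.+1) << x *+ 'C(l, i) *g ((k + i)%N, (l - i)%N) >>)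
    (f a b)) g.

End Substitution.

Section SubstitutionTheory.

(* the three substitutions above are of the form sub2 p (f a) g or
   sub2 p (f^~ b) g, p being the placement of the monomials *)
Record placement := Placement {
  place :> forall M : zmodType, nat -> nat -> M -> lpoly2 M;
  placeB : forall (M : zmodType) k, coef_additive (@place M k);
  mpol_map_place : forall (M N : zmodType) (f : M -> N) k l x, zmod_morphism f ->
    mpol_map f (@place M k l x) = @place N k l (f x)
}.

Definition sub2 (p : placement) (B M : zmodType) (F : B -> lpoly M)
    (g : lpoly B) : lpoly2 M :=
  mext (fun k b => mext (@place p M k) (F b)) g.

Fact place_monoB (q : nat -> nat -> nat * nat) (M : zmodType) k :
  coef_additive (fun l (x : M) => << x *g q k l >> : lpoly2 M).
Proof. by move=> l x y; rewrite raddfB. Qed.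

Fact mpol_map_place_mono (q : nat -> nat -> nat * nat) (M N : zmodType) (f : M -> N)
    k l x : zmod_morphism f ->
  mpol_map f (<< x *g q k l >> : lpoly2 M) = << f x *g q k l >>.
Proof. by move=> fB; rewrite mpol_mapU // zmod_morphism0. Qed.

Definition place_lam_mu := Placement
  (place_monoB (fun n m => (m, n))) (mpol_map_place_mono (fun n m => (m, n))).

Definition place_mu_lam := Placement
  (place_monoB (fun m n => (m, n))) (mpol_map_place_mono (fun m n => (m, n))).

Fact place_binB (M : zmodType) k : coef_additive (fun l (x : M) =>
  \sum_(i < l.+1) << x *+ 'C(l, i) *g ((k + i)%N, (l - i)%N) >> : lpoly2 M).
Proof.
move=> l x y; rewrite -sumrB; apply: eq_bigr => i _.
by rewrite mulrnBl raddfB.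
Qed.

Fact mpol_map_place_bin (M N : zmodType) (f : M -> N) k l x : zmod_morphism f ->
  mpol_map f (\sum_(i < l.+1) << x *+ 'C(l, i) *g ((k + i)%N, (l - i)%N) >>
    : lpoly2 M) =
  \sum_(i < l.+1) << f x *+ 'C(l, i) *g ((k + i)%N, (l - i)%N) >>.
Proof.
move=> fB; pose f' : {additive M -> N} :=
  HB.pack f (GRing.isZmodMorphism.Build M N f fB).
pose pf : {additive lpoly2 M -> lpoly2 N} := HB.pack (mpol_map f : _ -> lpoly2 N)
  (GRing.isZmodMorphism.Build (lpoly2 M) (lpoly2 N) (mpol_map f) (mpol_mapB fB)).
rewrite [LHS](raddf_sum pf); apply: eq_bigr => i _ /=.
rewrite mpol_mapU; last exact: zmod_morphism0.
by congr (<< _ *g _ >>); apply: (raddfMn f').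
Qed.

Definition place_lam_add := Placement place_binB mpol_map_place_bin.

Variables (p : placement).

Lemma sub_lam_muE (A B M : zmodType) (f : A -> B -> lpoly M) a g :
  sub_lam_mu f a g = sub2 place_lam_mu (f a) g.
Proof. by []. Qed.

Lemma sub_mu_lamE (A B M : zmodType) (f : A -> B -> lpoly M) a g :
  sub_mu_lam f a g = sub2 place_mu_lam (f a) g.
Proof. by []. Qed.

Lemma sub_lam_addE (A B M : zmodType) (f : A -> B -> lpoly M) g b :
  sub_lam_add f g b = sub2 place_lam_add (f^~ b) g.
Proof. by []. Qed.

Lemma sub2B (B M : zmodType) (F : B -> lpoly M) :
  zmod_morphism F -> zmod_morphism (sub2 p F).
Proof.
move=> FB; apply: mextB => k x y.
by rewrite FB; apply: (mextB (@placeB p M k)).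
Qed.

Lemma eq_sub2 (B M : zmodType) (F F' : B -> lpoly M) g :
  F =1 F' -> sub2 p F g = sub2 p F' g.
Proof. by move=> eqF; apply: eq_mext => k x; rewrite eqF. Qed.

Lemma sub2_fctB (B M : zmodType) (F F' : B -> lpoly M) g :
  sub2 p (fun b => F b - F' b) g = sub2 p F g - sub2 p F' g.
Proof.
rewrite /sub2 -mext_sub; apply: eq_mext => k x.
exact: (mextB (@placeB p M k)).
Qed.

Lemma sub2D (B M : zmodType) (F : B -> lpoly M) g h : zmod_morphism F ->
  sub2 p F (g + h) = sub2 p F g + sub2 p F h.
Proof. by move=> FB; apply: zmod_morphismD; apply: sub2B. Qed.

Lemma sub2_mpol_map (B B' M : zmodType) (F : B -> lpoly M) (h : B' -> B) g :
  F 0 = 0 -> h 0 = 0 -> sub2 p F (mpol_map h g) = sub2 p (F \o h) g.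
Proof.
move=> F0 h0; rewrite /sub2 mext_mpol_map // => k.
by rewrite F0 /mext msupp0 big_seq_fset0.
Qed.

Lemma mpol_map_sub2 (B M N : zmodType) (F : B -> lpoly M) (h : M -> N) g :
  zmod_morphism h -> mpol_map h (sub2 p F g) = sub2 p (fun b => mpol_map h (F b)) g.
Proof.
move=> hB; have h0 := zmod_morphism0 hB.
rewrite /sub2 (raddf_mext _ _ (mpol_mapB hB)); apply: eq_mext => k b.
rewrite (raddf_mext _ _ (mpol_mapB hB)) mext_mpol_map // => [|l].
  by apply: eq_mext => l x; rewrite mpol_map_place.
exact: zmod_morphism0 (@placeB p N k l).
Qed.

End SubstitutionTheory.

Section Sesquilinear.

Variables (K : fieldType).

(* modules over {poly K} = K[d], 'X acting as the derivation d *)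
Record sesquilinear (A B M : lmodType {poly K}) (f : A -> B -> lpoly M)
    : Prop := Sesquilinear {
  sesq_linl : forall (c : K) a a' b,
    f (c%:P *: a + a') b = c%:P *: f a b + f a' b;
  sesq_linr : forall (c : K) a b b',
    f a (c%:P *: b + b') = c%:P *: f a b + f a b';
  sesq_dl : forall a b, f ('X *: a) b = - lam (f a b);
  sesq_dr : forall a b, f a ('X *: b) = 'X *: f a b + lam (f a b)
}.

Lemma sesqBl (A B M : lmodType {poly K}) (f : A -> B -> lpoly M) b :
  sesquilinear f -> zmod_morphism (f^~ b).
Proof.
move=> sf x y; have := sesq_linl sf (-1) y x b.
by rewrite polyCN !scaleN1r addrC => ->; rewrite addrC.
Qed.

Lemma sesqBr (A B M : lmodType {poly K}) (f : A -> B -> lpoly M) a :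
  sesquilinear f -> zmod_morphism (f a).
Proof.
move=> sf x y; have := sesq_linr sf (-1) a y x.
by rewrite polyCN !scaleN1r addrC => ->; rewrite addrC.
Qed.

End Sesquilinear.

Section SesquilinearMaps.

Variables (K : fieldType) (A B M : lmodType {poly K}).

Definition is_sesquilinear : {pred A -> B -> lpoly M} :=
  fun f => `[< sesquilinear f >].

Fact is_sesquilinear_closed : zmod_closed is_sesquilinear.
Proof.
have lamB := @lamB M.
split.
  have lam0 := zmod_morphism0 lamB.
  apply/asboolP; split=> [c a a' b|c a b b'|a b|a b]; rewrite -[LHS]/0.
  - by rewrite -[RHS]/(_ *: 0 + 0) scaler0 addr0.
  - by rewrite -[RHS]/(_ *: 0 + 0) scaler0 addr0.
  - by rewrite -[RHS]/(- lam 0) lam0 oppr0.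
  - by rewrite -[RHS]/(_ *: 0 + lam 0) lam0 scaler0 addr0.
move=> f g /asboolP sf /asboolP sg; apply/asboolP; split=> [c a a' b|c a b b'|a b|a b].
- rewrite -[LHS]/(f _ b - g _ b) -[RHS]/(_ *: (f a b - g a b) + (f a' b - g a' b)).
  by rewrite (sesq_linl sf) (sesq_linl sg) scalerBr opprD addrACA.
- rewrite -[LHS]/(f a _ - g a _) -[RHS]/(_ *: (f a b - g a b) + (f a b' - g a b')).
  by rewrite (sesq_linr sf) (sesq_linr sg) scalerBr opprD addrACA.
- rewrite -[LHS]/(f _ b - g _ b) -[RHS]/(- lam (f a b - g a b)).
  by rewrite (sesq_dl sf) (sesq_dl sg) lamB opprB opprK addrC.
- rewrite -[LHS]/(f a _ - g a _).
  rewrite -[RHS]/(_ *: (f a b - g a b) + lam (f a b - g a b)).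
  by rewrite (sesq_dr sf) (sesq_dr sg) lamB scalerBr opprD addrACA.
Qed.

HB.instance Definition _ :=
  GRing.isZmodClosed.Build (A -> B -> lpoly M) is_sesquilinear
    is_sesquilinear_closed.

Record sesqMap := SesqMap {
  sesq_fun :> A -> B -> lpoly M;
  sesqMap_subproof : is_sesquilinear sesq_fun
}.

HB.instance Definition _ := [isSub for sesq_fun].
HB.instance Definition _ := [Choice of sesqMap by <:].
HB.instance Definition _ := [SubChoice_isSubZmodule of sesqMap by <:].

Definition mk_sesqMap (f : A -> B -> lpoly M) (sf : sesquilinear f) : sesqMap :=
  SesqMap (asboolT sf).

Lemma sesqMapP (f : sesqMap) : sesquilinear f.
Proof. exact/asboolP/sesqMap_subproof. Qed.

Lemma sesqMapE (f g : sesqMap) : (forall a b, f a b = g a b) -> f = g.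
Proof. by move=> fg; apply/val_inj/funext => a; apply/funext => b; apply: fg. Qed.

End SesquilinearMaps.

(* [a_lambda [b_mu c]] = [[a_lambda b]_(lambda + mu) c] + [b_mu [a_lambda c]] *)
Definition lambda_jacobi (K : fieldType) (R : lmodType {poly K})
    (br : R -> R -> lpoly R) : Prop :=
  forall a b c,
    sub_lam_mu br a (br b c) = sub_lam_add br (br a b) c + sub_mu_lam br b (br a c).

HB.mixin Record isLeibnizConformal (K : fieldType) R
    of GRing.Lmodule {poly K} R := {
  lbr : sesqMap R R R;
  lbr_jacobi : lambda_jacobi lbr
}.

#[short(type="lcaType")]
HB.structure Definition LeibnizConformal (K : fieldType) :=
  { R of isLeibnizConformal K R & GRing.Lmodule {poly K} R }.

(* a module viewed as a Leibniz conformal algebra with zero bracket *)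
Definition zeroLCA (K : fieldType) (H : lmodType {poly K}) : Type := H.

Section ZeroLCA.

Variables (K : fieldType) (H : lmodType {poly K}).

HB.instance Definition _ := GRing.Lmodule.on (zeroLCA H).

Fact zeroLCA_jacobi :
  lambda_jacobi (0 : sesqMap (zeroLCA H) (zeroLCA H) (zeroLCA H)).
Proof.
have mext0 (I : choiceType) (M V : zmodType) (F : I -> M -> V) : mext F 0 = 0.
  by rewrite /mext msupp0 big_seq_fset0.
by move=> a b c; rewrite /sub_lam_mu /sub_lam_add /sub_mu_lam !mext0 addr0.
Qed.

HB.instance Definition _ :=
  isLeibnizConformal.Build K (zeroLCA H) zeroLCA_jacobi.

End ZeroLCA.

Definition finitely_generated (A : nzRingType) (M : lmodType A) : Prop :=
  exists (n : nat) (e : 'I_n -> M),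
    forall x, exists c : 'I_n -> A, x = \sum_(i < n) c i *: e i.

(* Der^L(R); {linear R -> R} is linearity over {poly K} = K[d] *)
Record leftDer (K : fieldType) (R : lcaType K) := LeftDer {
  leftDer_fun :> {linear R -> R};
  leftDerP : forall a b,
    mpol_map leftDer_fun (lbr a b) = lbr a (leftDer_fun b) + lbr (leftDer_fun a) b
}.

Definition lca_morphism (K : fieldType) (R S : lcaType K) (f : R -> S) : Prop :=
  forall a b, mpol_map f (lbr a b) = lbr (f a) (f b).

Section Subtractions.

Variables (V : zmodType) (x y z t : V).

Fact addBB : (x + y) - (z + t) = (x - z) + (y - t).
Proof. by rewrite opprD addrACA. Qed.

Fact subBB : (x - y) - (z - t) = (x - z) - (y - t).
Proof. by rewrite !opprD addrACA. Qed.

Fact sub3C : x - t - y - z = x - y - z - t.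
Proof. by rewrite [RHS]addrAC; congr (_ - z); rewrite addrAC. Qed.

End Subtractions.

Fact alt6B (V : zmodType) (x1 x2 x3 x4 x5 x6 y1 y2 y3 y4 y5 y6 : V) :
  (x1 - y1) - (x2 - y2) - (x3 - y3) - (x4 - y4) - (x5 - y5) + (x6 - y6) =
  (x1 - x2 - x3 - x4 - x5 + x6) - (y1 - y2 - y3 - y4 - y5 + y6).
Proof.
rewrite [RHS]addBB; congr (_ + _); do 3! [rewrite [RHS]subBB; congr (_ - _)].
by rewrite [RHS]subBB.
Qed.

Fact alt6B3 (V : zmodType) (x1 x2 x3 x4 x5 x6 a1 a2 a3 a4 a5 a6
    b1 b2 b3 b4 b5 b6 c1 c2 c3 c4 c5 c6 : V) :
  (x1 - a1 - b1 - c1) - (x2 - b2 - a2 - c2) - (x3 - a3 - b3 - c3)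
  - (x4 - a4 - b4 - c4) - (x5 - b5 - a5 - c5) + (x6 - a6 - b6 - c6) =
  (x1 - x2 - x3 - x4 - x5 + x6) - (a1 - a2 - a3 - a4 - a5 + a6)
  - (b1 - b2 - b3 - b4 - b5 + b6) - (c1 - c2 - c3 - c4 - c5 + c6).
Proof. by rewrite [x2 - b2 - a2]addrAC [x5 - b5 - a5]addrAC 3!alt6B. Qed.

Fact delta1_identity (V : zmodType) (p q r s t u v w z : V) :
  (p + q + (r + s) - t) - (q + u - v) - (w + r - z) =
  (p - w) + (s - u) - (t - (z + v)).
Proof.
rewrite -[in RHS]addBB [RHS]subBB -[LHS]addrA -opprD.
have -> : q + u - v + (w + r - z) = (w + u - (z + v)) + (q + r).
  by rewrite opprD !addrA (ACl (4*2*6*3*1*5)).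
have -> : p + q + (r + s) - t = (p + s - t) + (q + r).
  by rewrite !addrA (ACl (1*4*5*2*3)).
by rewrite opprD addrACA subrr addr0.
Qed.

Fact cocycle_identity (V : zmodType)
    (t1 t2 t3 t4 t5 t6 x1 x2 x3 y1 y2 y3 z1 z2 z3 : V) :
    x1 = x3 + x2 -> z1 = z3 + z2 ->
    t1 = x1 - y1 -> t2 = x2 - y2 -> t3 = x3 - y3 ->
    t4 = y3 - z3 -> t5 = y2 - z2 -> t6 = y1 - z1 ->
  t1 - t2 - t3 - t4 - t5 + t6 = 0.
Proof.
move=> -> -> -> -> -> -> -> ->.
rewrite !opprD !opprK !addrA.
rewrite (ACl ((1*6)*(2*4)*(12*3)*(5*10)*(7*8)*(9*13)*(11*14))) /=.
by rewrite !subrr !addr0.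
Qed.

Section Cohomology.

(* R acts on H by  a |>_lambda h = la a h  and  h <|_lambda a = ra h a;
   these are the only data of the R-module H that enter below *)
Variables (K : fieldType) (R : lcaType K) (H : lmodType {poly K}).
Variables (la : sesqMap R H H) (ra : sesqMap H R H).

Definition delta1 (beta : {linear R -> H}) (a b : R) : lpoly H :=
  la a (beta b) + ra (beta a) b - mpol_map beta (lbr a b).

Definition delta2 (f : sesqMap R R H) (a b c : R) : lpoly2 H :=
  sub_lam_mu la a (f b c) - sub_mu_lam la b (f a c) - sub_lam_add ra (f a b) c
  - sub_lam_add f (lbr a b) c - sub_mu_lam f b (lbr a c)
  + sub_lam_mu f a (lbr b c).

Definition is_cocycle2 : {pred sesqMap R R H} :=
  fun f => `[< forall a b c, delta2 f a b c = 0 >].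

Lemma delta2B f g a b c : delta2 (f - g) a b c = delta2 f a b c - delta2 g a b c.
Proof.
rewrite /delta2 !(sub_lam_muE, sub_mu_lamE, sub_lam_addE).
have laB x := sesqBr x (sesqMapP la); have raB x := sesqBl x (sesqMapP ra).
rewrite -![(f - g) _ _]/(f _ _ - g _ _).
rewrite !(sub2B _ (laB _)) (sub2B _ (raB _)) !sub2_fctB.
exact: alt6B.
Qed.

Fact is_cocycle2_closed : zmod_closed is_cocycle2.
Proof.
split=> [|f g /asboolP Zf /asboolP Zg]; apply/asboolP => a b c.
  by rewrite -(subrr (0 : sesqMap R R H)) delta2B subrr.
by rewrite delta2B Zf Zg subr0.
Qed.

HB.instance Definition _ :=
  GRing.isZmodClosed.Build (sesqMap R R H) is_cocycle2 is_cocycle2_closed.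

(* Z^2(R, H) *)
Record cocycle2 := Cocycle2 {
  cocycle2_val :> sesqMap R R H;
  cocycle2_subproof : is_cocycle2 cocycle2_val
}.

HB.instance Definition _ := [isSub for cocycle2_val].
HB.instance Definition _ := [Choice of cocycle2 by <:].
HB.instance Definition _ := [SubChoice_isSubZmodule of cocycle2 by <:].

Lemma cocycle2P (f : cocycle2) a b c : delta2 f a b c = 0.
Proof. by move: a b c; apply/asboolP/cocycle2_subproof. Qed.

Definition is_coboundary2 : {pred cocycle2} :=
  fun f => `[< exists beta : {linear R -> H}, forall a b, f a b = delta1 beta a b >].

Lemma delta1B (beta gamma : {linear R -> H}) a b :
  delta1 (beta \- gamma) a b = delta1 beta a b - delta1 gamma a b.
Proof.
rewrite /delta1 (sesqBr a (sesqMapP la)) [ra _ b](sesqBl b (sesqMapP ra)).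
have -> : mpol_map (beta \- gamma) (lbr a b) =
    mpol_map beta (lbr a b) - mpol_map gamma (lbr a b).
  rewrite /mpol_map -mext_sub; apply: eq_mext => k x.
  by rewrite raddfB.
by rewrite [RHS]subBB; congr (_ - _); rewrite [RHS]addBB.
Qed.

Fact is_coboundary2_closed : zmod_closed is_coboundary2.
Proof.
split=> [|f g /asboolP[beta fE] /asboolP[gamma gE]]; apply/asboolP.
  exists (\0 \- \0) => a b.
  by rewrite delta1B subrr.
exists (beta \- gamma) => a b.
by rewrite delta1B -fE -gE.
Qed.

HB.instance Definition _ :=
  GRing.isZmodClosed.Build cocycle2 is_coboundary2 is_coboundary2_closed.

(* the quotient Z^2(R, H) / delta C^1(R, H) *)
Definition H2 := Quotient.quot is_coboundary2.
HB.instance Definition _ := GRing.Zmodule.on H2.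

Definition cohomology_class (f : cocycle2) : H2 := (\pi_H2 f)%qT.

End Cohomology.

Section SesquilinearTheory.

Variables (K : fieldType).

Lemma sesq_comp (A B M A' B' M' : lmodType {poly K}) (f : A -> B -> lpoly M)
    (u : {linear A' -> A}) (v : {linear B' -> B}) (w : {linear M -> M'}) :
  sesquilinear f -> sesquilinear (fun a b => mpol_map w (f (u a) (v b))).
Proof.
move=> sf; have wB : zmod_morphism w := raddfB w.
have pwB := mpol_mapB (I := nat) wB.
have pwD x y := zmod_morphismD x y pwB; have pwN x := zmod_morphismN x pwB.
have pwZ (a : {poly K}) (g : lpoly M) : mpol_map w (a *: g) = a *: mpol_map w g.
  apply/malgP => k; rewrite coef_mpol_map ?raddf0 // !coef_scale linearZ /=.
  by rewrite coef_mpol_map ?raddf0.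
split=> [c a a' b|c a b b'|a b|a b].
- by rewrite linearP (sesq_linl sf) pwD pwZ.
- by rewrite linearP (sesq_linr sf) pwD pwZ.
- by rewrite linearZ /= (sesq_dl sf) pwN mpol_map_lam.
- by rewrite linearZ /= (sesq_dr sf) pwD pwZ mpol_map_lam.
Qed.

Lemma sesq_sub (A B M : lmodType {poly K}) (f g : A -> B -> lpoly M) :
  sesquilinear f -> sesquilinear g -> sesquilinear (fun a b => f a b - g a b).
Proof. by move=> sf sg; apply: (sesqMapP (mk_sesqMap sf - mk_sesqMap sg)). Qed.

Lemma eq_sesq (A B M : lmodType {poly K}) (f g : A -> B -> lpoly M) :
  (forall a b, f a b = g a b) -> sesquilinear f -> sesquilinear g.
Proof.
by move=> fg sf; have -> : g = f by apply/funext => a; apply/funext => b.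
Qed.

Lemma mpol_map_id (I : choiceType) (M : zmodType) (g : mpol I M) : mpol_map idfun g = g.
Proof. by apply/malgP => k; rewrite coef_mpol_map. Qed.

Lemma sesq_inj (A B M N : lmodType {poly K}) (f : A -> B -> lpoly M)
    (w : {linear M -> N}) : injective w ->
  sesquilinear (fun a b => mpol_map w (f a b)) -> sesquilinear f.
Proof.
move=> w_inj sf; have wB : zmod_morphism w := raddfB w.
have pw_inj := mpol_map_inj (I := nat) wB w_inj.
have pwB := mpol_mapB (I := nat) wB.
have pwD x y := zmod_morphismD x y pwB; have pwN x := zmod_morphismN x pwB.
have pwZ (a : {poly K}) (g : lpoly M) : mpol_map w (a *: g) = a *: mpol_map w g.
  apply/malgP => k; rewrite coef_mpol_map ?raddf0 // !coef_scale linearZ /=.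
  by rewrite coef_mpol_map ?raddf0.
split=> [c a a' b|c a b b'|a b|a b]; apply: pw_inj.
- by rewrite (sesq_linl sf) pwD pwZ.
- by rewrite (sesq_linr sf) pwD pwZ.
- by rewrite (sesq_dl sf) pwN mpol_map_lam.
- by rewrite (sesq_dr sf) pwD pwZ mpol_map_lam.
Qed.

End SesquilinearTheory.

Section Pairs.

Variables (K : fieldType) (R : lcaType K) (H : lmodType {poly K}).
Variables (la : sesqMap R H H) (ra : sesqMap H R H).
Variables (dR : leftDer R) (dH : leftDer (zeroLCA H)).

(* membership of (dR, dH) in g(R, H) *)
Definition in_g : Prop :=
  (forall a h, mpol_map dH (la a h) = la a (dH h) + la (dR a) h) /\
  (forall h a, mpol_map dH (ra h a) = ra h (dR a) + ra (dH h) a).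

Definition Phi_fun (f : sesqMap R R H) (a b : R) : lpoly H :=
  mpol_map dH (f a b) - f (dR a) b - f a (dR b).

Let dH_linear : linear (dH : H -> H).
Proof. by move=> c x y; apply: (linearP dH). Qed.

Let dHl : {linear H -> H} := HB.pack (dH : H -> H)
  (GRing.isLinear.Build {poly K} H H *:%R (dH : H -> H) dH_linear).

Let dHB : zmod_morphism (dH : H -> H). Proof. exact: (raddfB dHl). Qed.
Let dH0 : (dH : H -> H) 0 = 0. Proof. exact: (raddf0 dHl). Qed.

Fact Phi_sesq f : sesquilinear (Phi_fun f).
Proof.
have sf := sesqMapP f.
have s1 := sesq_comp idfun idfun dHl sf.
have s2 := sesq_comp dR idfun idfun sf.
have s3 := sesq_comp idfun dR idfun sf.
apply: eq_sesq (sesq_sub (sesq_sub s1 s2) s3) => a b.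
by rewrite /= !mpol_map_id.
Qed.

Definition Phi (f : sesqMap R R H) : sesqMap R R H := mk_sesqMap (Phi_sesq f).

Let derB p (f : H -> lpoly H) (f' : H -> lpoly H) (g : lpoly H) :
    zmod_morphism f -> (forall h, mpol_map dH (f h) = f (dH h) + f' h) ->
  sub2 p f (mpol_map dH g) = mpol_map dH (sub2 p f g) - sub2 p f' g.
Proof.
move=> fB fD; rewrite sub2_mpol_map ?(zmod_morphism0 fB) //.
rewrite mpol_map_sub2 // -sub2_fctB; apply: eq_sub2 => h /=.
by rewrite fD addrK.
Qed.

Lemma delta2_Phi f a b c : in_g ->
  delta2 la ra (Phi f) a b c =
    mpol_map dH (delta2 la ra f a b c) - delta2 la ra f (dR a) b c
    - delta2 la ra f a (dR b) c - delta2 la ra f a b (dR c).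
Proof.
move=> [la_der ra_der]; rewrite /delta2 !(sub_lam_muE, sub_mu_lamE, sub_lam_addE).
have laB x := sesqBr x (sesqMapP la); have raB x := sesqBl x (sesqMapP ra).
have fBl x := sesqBl x (sesqMapP f); have fBr x := sesqBr x (sesqMapP f).
have subl p x y z : sub2 p (la x) (Phi f y z) =
    mpol_map dH (sub2 p (la x) (f y z)) - sub2 p (la (dR x)) (f y z)
    - sub2 p (la x) (f (dR y) z) - sub2 p (la x) (f y (dR z)).
  rewrite -[Phi f y z]/(mpol_map dH (f y z) - f (dR y) z - f y (dR z)).
  by rewrite !(sub2B _ (laB x)) (derB _ _ (laB x) (la_der x)).
have subr p x y z : sub2 p (ra^~ z) (Phi f x y) =
    mpol_map dH (sub2 p (ra^~ z) (f x y)) - sub2 p (ra^~ z) (f (dR x) y)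
    - sub2 p (ra^~ z) (f x (dR y)) - sub2 p (ra^~ (dR z)) (f x y).
  rewrite -[Phi f x y]/(mpol_map dH (f x y) - f (dR x) y - f x (dR y)).
  have ra_der' h : mpol_map dH (ra h z) = ra (dH h) z + ra h (dR z).
    by rewrite ra_der addrC.
  rewrite !(sub2B _ (raB z)) (derB p (f x y) (raB z) ra_der').
  exact: sub3C.
have subF p (F F' : R -> lpoly H) x y : zmod_morphism F ->
    sub2 p (fun z => mpol_map dH (F z) - F (dR z) - F' z) (lbr x y) =
    mpol_map dH (sub2 p F (lbr x y)) - sub2 p F (lbr (dR x) y)
    - sub2 p F (lbr x (dR y)) - sub2 p F' (lbr x y).
  move=> FB; rewrite 2!sub2_fctB -(mpol_map_sub2 p F _ dHB).
  rewrite -(@sub2_mpol_map p _ _ _ F dR) ?raddf0 ?(zmod_morphism0 FB) //.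
  rewrite leftDerP sub2D // [sub2 _ _ (lbr x (dR y)) + _]addrC.
  by congr (_ - _); rewrite opprD addrA.
have subF' p (F F' : R -> lpoly H) x y : zmod_morphism F ->
    sub2 p (fun z => mpol_map dH (F z) - F' z - F (dR z)) (lbr x y) =
    mpol_map dH (sub2 p F (lbr x y)) - sub2 p F' (lbr x y)
    - sub2 p F (lbr (dR x) y) - sub2 p F (lbr x (dR y)).
  move=> FB; rewrite [RHS]sub3C -(subF p F F' _ _ FB).
  by apply: eq_sub2 => z; rewrite addrAC.
have sf1 p x y z : sub2 p ((Phi f)^~ z) (lbr x y) =
    mpol_map dH (sub2 p (f^~ z) (lbr x y)) - sub2 p (f^~ z) (lbr (dR x) y)
    - sub2 p (f^~ z) (lbr x (dR y)) - sub2 p (f^~ (dR z)) (lbr x y).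
  exact: subF.
have sf2 p x y z : sub2 p (Phi f x) (lbr y z) =
    mpol_map dH (sub2 p (f x) (lbr y z)) - sub2 p (f (dR x)) (lbr y z)
    - sub2 p (f x) (lbr (dR y) z) - sub2 p (f x) (lbr y (dR z)).
  exact: subF'.
rewrite !subl subr sf1 !sf2.
have pB := mpol_mapB (I := (nat * nat)%type) dHB.
have pH6 (x1 x2 x3 x4 x5 x6 : lpoly2 H) :
    mpol_map dH (x1 - x2 - x3 - x4 - x5 + x6) =
    mpol_map dH x1 - mpol_map dH x2 - mpol_map dH x3 - mpol_map dH x4
    - mpol_map dH x5 + mpol_map dH x6.
  by rewrite (zmod_morphismD _ _ pB) !pB.
by rewrite pH6; exact: alt6B3.
Qed.

Lemma delta1_Phi (beta : {linear R -> H}) : in_g ->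
  {gamma : {linear R -> H} | forall (f : sesqMap R R H),
    (forall a b, f a b = delta1 la ra beta a b) ->
    forall a b, Phi f a b = delta1 la ra gamma a b}.
Proof.
move=> [la_der ra_der].
have [gamma gE] : {gamma : {linear R -> H} |
    forall x, gamma x = dH (beta x) - beta (dR x)}.
  by exists ((dHl \o beta) \- (beta \o dR)).
exists gamma => f fE a b.
have b0 := zmod_morphism0 (raddfB beta); have d0 := raddf0 dR.
have mgE : mpol_map gamma (lbr a b) =
    mpol_map dH (mpol_map beta (lbr a b))
    - (mpol_map beta (lbr a (dR b)) + mpol_map beta (lbr (dR a) b)).
  rewrite -(zmod_morphismD _ _ (mpol_mapB (raddfB beta))) -leftDerP.
  rewrite !mpol_map_comp // /mpol_map -mext_sub; apply: eq_mext => k x.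
  by rewrite gE raddfB.
rewrite -[Phi f a b]/(mpol_map dH (f a b) - f (dR a) b - f a (dR b)) !fE /delta1.
rewrite mgE !gE (mpol_mapB dHB) (zmod_morphismD _ _ (mpol_mapB dHB)).
rewrite la_der ra_der (sesqBr a (sesqMapP la)).
rewrite [ra (_ - _) b](sesqBl b (sesqMapP ra)).
exact: delta1_identity.
Qed.

Fact Phi_cocycle2 (f : cocycle2 la ra) : in_g -> is_cocycle2 la ra (Phi f).
Proof.
move=> dg; apply/asboolP => a b c.
rewrite delta2_Phi // !cocycle2P !subr0.
by apply: zmod_morphism0; apply: mpol_mapB.
Qed.

Section InducedMap.

Hypothesis dg : in_g.

Definition Phi_Z2 (f : cocycle2 la ra) : cocycle2 la ra :=
  Cocycle2 (Phi_cocycle2 f dg).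

(* the map induced by Phi on H^2; by Phi_classE it does not depend on the
   representative chosen by repr *)
Definition Phi_H2 (x : H2 la ra) : H2 la ra :=
  cohomology_class (Phi_Z2 (repr x)).

Lemma Phi_classE (f : cocycle2 la ra) :
  Phi_H2 (cohomology_class f) = cohomology_class (Phi_Z2 f).
Proof.
rewrite /Phi_H2 /cohomology_class; apply/eqP; rewrite -Quotient.idealrBE.
set g := repr _.
have /asboolP[beta gfE] : g - f \in @is_coboundary2 _ _ _ la ra.
  by rewrite Quotient.idealrBE reprK.
apply/asboolP; have [gamma gammaP] := delta1_Phi beta dg.
exists gamma => a b; rewrite -(gammaP (g - f : cocycle2 la ra)) //.
rewrite -[RHS]/(mpol_map dH (g a b - f a b) - (g (dR a) b - f (dR a) b)
  - (g a (dR b) - f a (dR b))).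
rewrite (mpol_mapB dHB) -[LHS]/(Phi_fun g a b - Phi_fun f a b) /Phi_fun.
by rewrite [LHS]subBB; congr (_ - _); rewrite [LHS]subBB.
Qed.

End InducedMap.

End Pairs.

Section AbelianExtension.

Variables (K : fieldType) (R E : lcaType K) (H : lmodType {poly K}).

(* 0 -> H -> E -> R -> 0 *)
Record abelian_extension := AbelianExtension {
  ext_alpha : {linear H -> E};
  ext_p : {linear E -> R};
  ext_alpha_morphism : lca_morphism (R := zeroLCA H) (S := E) ext_alpha;
  ext_p_morphism : lca_morphism ext_p;
  ext_alpha_inj : injective ext_alpha;
  ext_exact : forall x, ext_p x = 0 <-> exists h, ext_alpha h = x;
  ext_p_surj : forall a, exists x, ext_p x = a
}.

Variable X : abelian_extension.

Notation alpha := (ext_alpha X).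
Notation p := (ext_p X).

Record ext_section := ExtSection {
  ext_section_fun :> {linear R -> E};
  ext_sectionK : forall a, p (ext_section_fun a) = a
}.

Definition extensible (dR : leftDer R) (dH : leftDer (zeroLCA H)) : Prop :=
  exists dE : leftDer E,
    (forall h, dE (alpha h) = alpha (dH h)) /\ (forall x, dR (p x) = p (dE x)).

(* the identification of alpha(H) with H; 0 outside alpha(H) *)
Definition alpha_inv (x : E) : H := xget 0 [set h | alpha h = x].

Lemma alpha_invK x : p x = 0 -> alpha (alpha_inv x) = x.
Proof.
move=> /(ext_exact X x)[h hx]; rewrite /alpha_inv.
by case: xgetP => [h' _ //|/(_ h)]; case.
Qed.

Lemma alpha_inv0 : alpha_inv 0 = 0.
Proof. by apply: (@ext_alpha_inj X); rewrite alpha_invK !raddf0. Qed.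

Lemma mpol_map_alpha_invK (g : lpoly E) :
  mpol_map p g = 0 -> mpol_map alpha (mpol_map alpha_inv g) = g.
Proof.
move=> /malgP pg0; apply/malgP => k.
rewrite !coef_mpol_map ?raddf0 ?alpha_inv0 // alpha_invK //.
by have := pg0 k; rewrite coef_mpol_map ?raddf0.
Qed.

Lemma p_alpha h : p (alpha h) = 0.
Proof. by apply/ext_exact; exists h. Qed.

Variable s : ext_section.

(* a |>_lambda h = [s(a)_lambda h],  h <|_lambda a = [h_lambda s(a)],
   chi_lambda(a, b) = [s(a)_lambda s(b)] - s([a_lambda b]) *)
Definition act_l_fun (a : R) (h : H) : lpoly H :=
  mpol_map alpha_inv (lbr (s a) (alpha h)).

Definition act_r_fun (h : H) (a : R) : lpoly H :=
  mpol_map alpha_inv (lbr (alpha h) (s a)).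

Definition chi_fun (a b : R) : lpoly H :=
  mpol_map alpha_inv (lbr (s a) (s b) - mpol_map s (lbr a b)).

Let pB : zmod_morphism p. Proof. exact: raddfB. Qed.
Let sB : zmod_morphism s. Proof. exact: raddfB. Qed.
Let alphaB : zmod_morphism alpha. Proof. exact: raddfB. Qed.

Lemma act_lE a h : mpol_map alpha (act_l_fun a h) = lbr (s a) (alpha h).
Proof.
apply: mpol_map_alpha_invK; rewrite ext_p_morphism p_alpha.
exact: zmod_morphism0 (sesqBr _ (sesqMapP lbr)).
Qed.

Lemma act_rE h a : mpol_map alpha (act_r_fun h a) = lbr (alpha h) (s a).
Proof.
apply: mpol_map_alpha_invK; rewrite ext_p_morphism p_alpha.
exact: zmod_morphism0 (sesqBl _ (sesqMapP lbr)).
Qed.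

Lemma chiE a b :
  mpol_map alpha (chi_fun a b) = lbr (s a) (s b) - mpol_map s (lbr a b).
Proof.
apply: mpol_map_alpha_invK; rewrite (mpol_mapB pB) ext_p_morphism.
rewrite !ext_sectionK mpol_map_comp ?raddf0 //.
rewrite (eq_mpol_map (h := idfun)) ?mpol_map_id ?subrr // => x /=.
exact: ext_sectionK.
Qed.

Fact act_l_sesq : sesquilinear act_l_fun.
Proof.
apply: (sesq_inj (@ext_alpha_inj X)).
apply: eq_sesq (sesq_comp s alpha idfun (sesqMapP lbr)) => a h.
by rewrite act_lE mpol_map_id.
Qed.

Fact act_r_sesq : sesquilinear act_r_fun.
Proof.
apply: (sesq_inj (@ext_alpha_inj X)).
apply: eq_sesq (sesq_comp alpha s idfun (sesqMapP lbr)) => h a.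
by rewrite act_rE mpol_map_id.
Qed.

Fact chi_sesq : sesquilinear chi_fun.
Proof.
apply: (sesq_inj (@ext_alpha_inj X)).
have s1 := sesq_comp s s idfun (sesqMapP (@lbr K E)).
have s2 := sesq_comp idfun idfun s (sesqMapP (@lbr K R)).
by apply: eq_sesq (sesq_sub s1 s2) => a b; rewrite chiE mpol_map_id.
Qed.

Definition act_l : sesqMap R H H := mk_sesqMap act_l_sesq.
Definition act_r : sesqMap H R H := mk_sesqMap act_r_sesq.
Definition chi : sesqMap R R H := mk_sesqMap chi_sesq.

Fact chi_is_cocycle2 : is_cocycle2 act_l act_r chi.
Proof.
apply/asboolP => a b c.
have paB := mpol_mapB (I := (nat * nat)%type) alphaB.
have pa_inj := mpol_map_inj (I := (nat * nat)%type) alphaB (@ext_alpha_inj X).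
apply: pa_inj; rewrite (zmod_morphism0 paB) /delta2.
rewrite (zmod_morphismD _ _ paB) !paB.
rewrite !(sub_lam_muE, sub_mu_lamE, sub_lam_addE).
have brl (x : E) := sesqBl x (sesqMapP (@lbr K E)).
have brr (x : E) := sesqBr x (sesqMapP (@lbr K E)).
have al0 : alpha 0 = 0 := raddf0 _.
have s0 : s 0 = 0 := raddf0 _.
have mapl q x y z : mpol_map alpha (sub2 q (act_l x) (chi y z)) =
    sub2 q (lbr (s x)) (lbr (s y) (s z))
    - sub2 q (lbr (s x)) (mpol_map s (lbr y z)).
  rewrite -(sub2B _ (brr _)) -chiE [RHS]sub2_mpol_map ?(zmod_morphism0 (brr _)) //.
  rewrite (mpol_map_sub2 _ _ _ alphaB).
  apply: (eq_sub2 (F' := lbr (s x) \o alpha) q (chi_fun y z)) => h.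
  exact: act_lE.
have mapr q x y z : mpol_map alpha (sub2 q (act_r^~ z) (chi x y)) =
    sub2 q (lbr^~ (s z)) (lbr (s x) (s y))
    - sub2 q (lbr^~ (s z)) (mpol_map s (lbr x y)).
  rewrite -(sub2B _ (brl _)) -chiE [RHS]sub2_mpol_map ?(zmod_morphism0 (brl _)) //.
  rewrite (mpol_map_sub2 _ _ _ alphaB).
  apply: (eq_sub2 (F' := lbr^~ (s z) \o alpha) q (chi_fun x y)) => h.
  exact: act_rE.
have mapchil q x y z : mpol_map alpha (sub2 q (chi x) (lbr y z)) =
    sub2 q (lbr (s x)) (mpol_map s (lbr y z))
    - mpol_map s (sub2 q (lbr x) (lbr y z)).
  rewrite sub2_mpol_map ?(zmod_morphism0 (brr _)) // !mpol_map_sub2 //.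
  by rewrite -sub2_fctB; apply: eq_sub2 => t; apply: chiE.
have mapchir q x y z : mpol_map alpha (sub2 q (chi^~ z) (lbr x y)) =
    sub2 q (lbr^~ (s z)) (mpol_map s (lbr x y))
    - mpol_map s (sub2 q (lbr^~ z) (lbr x y)).
  rewrite sub2_mpol_map ?(zmod_morphism0 (brl _)) // !mpol_map_sub2 //.
  by rewrite -sub2_fctB; apply: eq_sub2 => t; apply: chiE.
have jE : sub2 place_lam_mu (lbr (s a)) (lbr (s b) (s c)) =
    sub2 place_lam_add (lbr^~ (s c)) (lbr (s a) (s b))
    + sub2 place_mu_lam (lbr (s b)) (lbr (s a) (s c)).
  exact: lbr_jacobi.
have jR : mpol_map s (sub2 place_lam_mu (lbr a) (lbr b c)) =
    mpol_map s (sub2 place_lam_add (lbr^~ c) (lbr a b))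
    + mpol_map s (sub2 place_mu_lam (lbr b) (lbr a c)).
  by rewrite -(zmod_morphismD _ _ (mpol_mapB sB)); congr mpol_map; apply: lbr_jacobi.
exact: (cocycle_identity jE jR (mapl _ a b c) (mapl _ b a c) (mapr _ a b c)
  (mapchir _ a b c) (mapchil _ b a c) (mapchil _ a b c)).
Qed.

Definition chi_Z2 : cocycle2 act_l act_r := Cocycle2 chi_is_cocycle2.

(* W(dR, dH) = Phi(dR, dH)([chi]) for (dR, dH) in g(R, H) *)
Definition Wells (dR : leftDer R) (dH : leftDer (zeroLCA H))
    (dg : in_g act_l act_r dR dH) : H2 act_l act_r :=
  Phi_H2 dg (cohomology_class chi_Z2).

End AbelianExtension.

(* Main.v *)
(** A [K[d]]-linear map [dE] lifting [(dR, dH)] has the form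
    [dE (s a) = s (dR a) + alpha (beta a)] and [dE (alpha h) = alpha (dH h)]
    for some [beta] in [C^1(R, H)], and every [beta] arises in this way since
    [E] is the direct sum of [s R] and [alpha H].  The failure of [dE] to be a
    derivation is biadditive, so it is determined on the two summands: on
    [(s a, alpha h)] and [(alpha h, s a)] it is the failure of the two
    equations of [g(R, H)], on [(s a, s b)] it is [Phi(chi) - delta beta],
    and on [(alpha h, alpha h')] it vanishes. *)
Require Import Defs.
From HB Require Import structures.
From mathcomp Require Import all_boot all_algebra.
From mathcomp Require Import boolp classical_sets functions reals complex.

Set Implicit Arguments.
Unset Strict Implicit.
Unset Printing Implicit Defensive.

Import GRing.Theory.
Local Open Scope ring_scope.

Lemma mpol_map_fctD (I : choiceType) (M N : zmodType) (f g : M -> N)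
    (x : mpol I M) :
  f 0 = 0 -> g 0 = 0 ->
  mpol_map (fun m => f m + g m) x = mpol_map f x + mpol_map g x.
Proof.
move=> f0 g0; apply/monalg.malgP => k.
by rewrite monalg.mcoeffD !coef_mpol_map ?f0 ?g0 ?addr0.
Qed.

(** Here [D] is [dE] of the bracket of [s a] and [s b]; [v1], [v2] are the brackets of [s a] with
    [s (dR b)], [alpha (beta b)], and [v3], [v4] those of [s (dR a)], [alpha (beta a)] with [s b].
    The terms [S1], [S2], [B] are [s [a, dR b]], [s [dR a, b]], [alpha (beta [a, b])], and
    cancel. *)
Fact der_defect_identity (V : zmodType) (D S1 S2 B v1 v2 v3 v4 : V) :
  D - ((v1 + v2) + (v3 + v4)) =
  D - (S1 + S2 + B) - (v3 - S2) - (v1 - S1) - (v2 + v4 - B).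
Proof.
rewrite -[RHS]addrA -opprD -[RHS]addrA -opprD -[RHS]addrA -opprD.
congr (_ - _); rewrite !addrA (ACl ((6*8)*(4*9)*(1*7)*(2*5)*(3*10))) /=.
by rewrite !subrr !addr0 !addrA.
Qed.

Section Defect.

Variables (K : fieldType) (R E : lcaType K) (H : lmodType {poly K}).
Variables (X : abelian_extension R E H) (s : ext_section X).
Variables (dR : leftDer R) (dH : leftDer (zeroLCA H)).

Notation alpha := (ext_alpha X).
Notation p := (ext_p X).

Let dH0 : (dH : H -> H) 0 = 0. Proof. exact: (raddf0 dH). Qed.

Let brBl (x : E) := sesqBl x (sesqMapP (@lbr K E)).
Let brBr (x : E) := sesqBr x (sesqMapP (@lbr K E)).
Let brDl (z x y : E) : lbr (x + y) z = lbr x z + lbr y z.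
Proof. exact: zmod_morphismD _ _ (brBl z). Qed.
Let brDr (z x y : E) : lbr z (x + y) = lbr z x + lbr z y.
Proof. exact: zmod_morphismD _ _ (brBr z). Qed.

(** Exactness provides preimages under [alpha], and injectivity makes their choice linear. This
    yields both [beta] and the projection of [E] onto [H]. *)
Lemma linear_lift_alpha (U : lmodType {poly K}) (f : {linear U -> E}) :
  (forall u, p (f u) = 0) ->
  {g : {linear U -> H} | forall u, alpha (g u) = f u}.
Proof.
move=> pf0; pose g u := alpha_inv X (f u).
have gE u : alpha (g u) = f u by apply: alpha_invK.
have g_linear : linear g.
  move=> c u v; apply: (@ext_alpha_inj _ _ _ _ X).
  by rewrite linearP !gE linearP.
pose gl : {linear U -> H} :=
  HB.pack g (GRing.isLinear.Build {poly K} U H *:%R g g_linear).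
by exists gl.
Qed.

Lemma lbr_alpha2 h h' : lbr (alpha h) (alpha h') = 0 :> lpoly E.
Proof.
rewrite -(ext_alpha_morphism X).
exact: zmod_morphism0 (mpol_mapB (raddfB alpha)).
Qed.

Definition der_defect (dE : E -> E) (x y : E) : lpoly E :=
  mpol_map dE (lbr x y) - (lbr x (dE y) + lbr (dE x) y).

Section Lift.

Variables (dE : {linear E -> E}) (beta : {linear R -> H}).
Hypothesis dE_alpha : forall h, dE (alpha h) = alpha (dH h).
Hypothesis dE_s : forall a, dE (s a) = s (dR a) + alpha (beta a).

Let dEB : zmod_morphism dE. Proof. exact: raddfB. Qed.
Let pdED (g h : lpoly E) :
  mpol_map dE (g + h) = mpol_map dE g + mpol_map dE h.
Proof. exact: zmod_morphismD _ _ (mpol_mapB dEB). Qed.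

Let alphaB := mpol_mapB (I := nat) (raddfB alpha).
Let alphaD (g h : lpoly H) :
  mpol_map alpha (g + h) = mpol_map alpha g + mpol_map alpha h.
Proof. exact: zmod_morphismD _ _ alphaB. Qed.

Lemma mpol_map_dE_alpha (g : lpoly H) :
  mpol_map dE (mpol_map alpha g) = mpol_map alpha (mpol_map (dH : H -> H) g).
Proof. by rewrite !mpol_map_comp ?raddf0 //; apply: eq_mpol_map. Qed.

Lemma mpol_map_dE_s (g : lpoly R) :
  mpol_map dE (mpol_map s g) =
    mpol_map s (mpol_map dR g) + mpol_map alpha (mpol_map beta g).
Proof.
rewrite !mpol_map_comp ?raddf0 // -mpol_map_fctD /= ?raddf0 //.
exact: eq_mpol_map.
Qed.

Lemma der_defect_addl x x' y :
  der_defect dE (x + x') y = der_defect dE x y + der_defect dE x' y.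
Proof.
rewrite /der_defect (raddfD dE) !brDl pdED -[RHS]addBB; congr (_ - _).
by rewrite addrACA.
Qed.

Lemma der_defect_addr x y y' :
  der_defect dE x (y + y') = der_defect dE x y + der_defect dE x y'.
Proof.
rewrite /der_defect (raddfD dE) !brDr pdED -[RHS]addBB; congr (_ - _).
by rewrite addrACA.
Qed.

Lemma der_defect_alpha2 h h' : der_defect dE (alpha h) (alpha h') = 0.
Proof.
rewrite /der_defect !dE_alpha !lbr_alpha2 addr0 subr0.
exact: zmod_morphism0 (mpol_mapB (I := nat) dEB).
Qed.

(** The part [alpha (beta a)] of [dE (s a)] has zero bracket with [alpha h], so [beta] drops out;
    likewise with the arguments exchanged. *)
Lemma der_defect_s_alpha a h :
  der_defect dE (s a) (alpha h) =
    mpol_map alpha (mpol_map (dH : H -> H) (act_l s a h)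
      - (act_l s a (dH h) + act_l s (dR a) h)).
Proof.
rewrite alphaB alphaD !act_lE -mpol_map_dE_alpha act_lE /der_defect.
by rewrite dE_alpha dE_s brDl lbr_alpha2 addr0.
Qed.

Lemma der_defect_alpha_s h a :
  der_defect dE (alpha h) (s a) =
    mpol_map alpha (mpol_map (dH : H -> H) (act_r s h a)
      - (act_r s h (dR a) + act_r s (dH h) a)).
Proof.
rewrite alphaB alphaD !act_rE -mpol_map_dE_alpha act_rE /der_defect.
by rewrite dE_alpha dE_s brDr lbr_alpha2 addr0.
Qed.

Lemma der_defect_s2 a b :
  der_defect dE (s a) (s b) =
    mpol_map alpha (Phi dR dH (chi s) a b
      - delta1 (act_l s) (act_r s) beta a b).
Proof.
rewrite -[Phi _ _ _ _ _]/(mpol_map (dH : H -> H) (chi s a b)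
  - chi s (dR a) b - chi s a (dR b)) /delta1.
rewrite 4!alphaB alphaD act_lE act_rE !chiE -mpol_map_dE_alpha chiE.
rewrite (mpol_mapB (I := nat) dEB) mpol_map_dE_s leftDerP.
rewrite (zmod_morphismD _ _ (mpol_mapB (I := nat) (raddfB s))).
rewrite /der_defect !dE_s brDl brDr.
exact: der_defect_identity.
Qed.

End Lift.

(** By the defect formulas and injectivity of [alpha], the conditions on the right say that the lift
    given by [beta] is a derivation. *)
Lemma extensible_lift :
  extensible X dR dH <->
  exists2 beta : {linear R -> H},
    (forall a h, mpol_map (dH : H -> H) (act_l s a h) =
      act_l s a (dH h) + act_l s (dR a) h) /\
    (forall h a, mpol_map (dH : H -> H) (act_r s h a) =
      act_r s h (dR a) + act_r s (dH h) a)
    & forall a b, Phi dR dH (chi s) a b = delta1 (act_l s) (act_r s) beta a b.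
Proof.
have alphaB := mpol_mapB (I := nat) (raddfB alpha).
have alpha_inj := mpol_map_inj (I := nat) (raddfB alpha) (@ext_alpha_inj _ _ _ _ X).
have alphaI0 (g h : lpoly H) : mpol_map alpha (g - h) = 0 -> g = h.
  move=> gh0; apply/eqP; rewrite -subr_eq0; apply/eqP/alpha_inj.
  by rewrite gh0 (zmod_morphism0 alphaB).
split=> [[dE [dE_alpha dE_p]]|[beta [la_der ra_der] PhiE]].
  (* Since [p] intertwines [dE] and [dR], the difference of [dE \o s] and [s \o dR] takes values in
     the kernel of [p]. *)
  have [a|beta betaE] := @linear_lift_alpha R ((dE \o s) \- (s \o dR)).
    by rewrite raddfB /= -dE_p !ext_sectionK subrr.
  have dE_s a : dE (s a) = s (dR a) + alpha (beta a).
    by rewrite betaE /= addrC subrK.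
  have defect0 x y : der_defect dE x y = 0 by rewrite /der_defect leftDerP subrr.
  exists beta; [split=> a h|move=> a b]; apply: alphaI0.
  - by rewrite -(der_defect_s_alpha dE_alpha dE_s).
  - by rewrite -(der_defect_alpha_s dE_alpha dE_s).
  - by rewrite -(der_defect_s2 dE_alpha dE_s).
(* [q] is the projection of [E] onto [H] along the image of [s]. *)
have [x|q qE] := @linear_lift_alpha E (idfun \- (s \o p)).
  by rewrite raddfB /= ext_sectionK subrr.
(* [zeroLCA H] unfolds to [H]; this retyping allows composition with [q] and [alpha]. *)
pose dHl : {linear H -> H} := dH.
have [dE dEE] : {dE : {linear E -> E} |
    forall x, dE x = s (dR (p x)) + alpha (beta (p x)) + alpha (dH (q x))}.
  by exists (((s \o dR \o p) \+ (alpha \o beta \o p)) \+ (alpha \o dHl \o q)).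
have q_alpha h : q (alpha h) = h.
  apply: (@ext_alpha_inj _ _ _ _ X).
  by rewrite qE /= p_alpha raddf0 subr0.
have q_s a : q (s a) = 0.
  apply: (@ext_alpha_inj _ _ _ _ X).
  by rewrite qE /= ext_sectionK subrr raddf0.
have dE_alpha h : dE (alpha h) = alpha (dH h).
  by rewrite dEE q_alpha p_alpha !raddf0 !add0r.
have dE_s a : dE (s a) = s (dR a) + alpha (beta a).
  by rewrite dEE q_s ext_sectionK dH0 raddf0 addr0.
have decomp x : x = s (p x) + alpha (q x) by rewrite qE /= addrC subrK.
have dE_der x y : mpol_map dE (lbr x y) = lbr x (dE y) + lbr (dE x) y.
  (* Splitting both arguments along [decomp] leaves the four defects computed above. *)
  apply/eqP; rewrite -subr_eq0 -/(der_defect dE x y) [x]decomp [y]decomp.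
  rewrite der_defect_addl !der_defect_addr.
  rewrite (der_defect_s2 dE_alpha dE_s) (der_defect_s_alpha dE_alpha dE_s).
  rewrite (der_defect_alpha_s dE_alpha dE_s) (der_defect_alpha2 dE_alpha).
  by rewrite PhiE la_der ra_der !subrr (zmod_morphism0 alphaB) !addr0.
exists (LeftDer dE_der); split=> [//|x] /=.
by rewrite dEE !raddfD /= ext_sectionK !p_alpha !addr0.
Qed.

(** The induced map may be evaluated on the representative [chi], and a class vanishes exactly when
    its representative is a coboundary. *)
Lemma Wells_eq0 (dg : in_g (act_l s) (act_r s) dR dH) :
  Wells dg = 0 <->
  exists beta : {linear R -> H}, forall a b,
    Phi dR dH (chi s) a b = delta1 (act_l s) (act_r s) beta a b.
Proof.
have -> : (Wells dg = 0) = (Phi_Z2 dg (chi_Z2 s) \in @is_coboundary2 _ _ _ _ _).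
  have class0 : cohomology_class (0 : cocycle2 (act_l s) (act_r s)) = 0.
    exact: pi_zeror.
  (* Equality in the quotient is membership of a difference, hence the subtraction of 0. *)
  rewrite /Wells Phi_classE -[X in X \in _]subr0 Quotient.idealrBE -class0.
  by apply/propext; split=> /eqP.
by split=> [/asboolP|] // PhiE; apply/asboolP.
Qed.

End Defect.

Theorem theorem6p6 (T : realType) (R E : lcaType T[i]) (H : lmodType {poly T[i]})
  (fgR : finitely_generated R) (fgE : finitely_generated E)
  (fgH : finitely_generated H)
  (X : abelian_extension R E H) (s : ext_section X)
  (dR : leftDer R) (dH : leftDer (zeroLCA H)) :
  extensible X dR dH <->
  exists dg : in_g (act_l s) (act_r s) dR dH, Wells dg = 0.
Proof.
(* The equations on the actions are [in_g] unfolded and do not involve [beta], so they can serve as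
   [dg] before [beta] is chosen. *)
rewrite (extensible_lift s); split=> [[beta dg PhiE]|[dg /Wells_eq0[beta PhiE]]].
  by exists dg; apply/Wells_eq0; exists beta.
by exists beta.
Qed.
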